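(* Fix a topological space $\underline{Z}$. $(\mathbb{R}_0,\leq_0)$ is distributive: whenever $R$ and $(S_i)_{i\in I}$ are relations with codomain $\underline{Z}$ (viewed as problems) satisfying $R\leq_0\ \uparrow S_i\uparrow_{i\in I}$, there are relations $(R_i)_{i\in I}$ with codomain $\underline{Z}$ such that $R_i\leq_0 S_i$ for all $i\in I$ and $R\equiv_0\ \uparrow R_i\uparrow_{i\in I}$.
   Context: A partial function $G:\subseteq X\to Y$ is continuous if continuous on $\operatorname{dom}(G)$ with the subspace topology. A problem $P:\underline{X}\to\underline{Z}$ is a set of partial functions from $\underline{X}$ to $\underline{Z}$. A relation $R\subseteq X\times Z$ is identified with the problem of its choice functions, i.e. functions $f$ defined on $\{x\mid\exists z\,(x,z)\in R\}$ with $(x,f(x))\in R$. For problems $P:\underline{X}\to\underline{Z}$, $Q:\underline{Y}\to\underline{Z}$, $P\leq_0 Q$ means there is a continuous partial $G:\subseteq\underline{X}\to\underline{Y}$ with $g\circ G\in P$ for all $g\in Q$; $\equiv_0$ is the induced equivalence, and $\mathbb{R}_0$ is the class of equivalence classes of relations with codomain $\underline{Z}$. Coproduct $\coprod_i\underline{X}_i=\bigcup_i\{i\}\times X_i$ with topology generated by the sets $\{i\}\times U$; $\uparrow f_i\uparrow_{i\in I}(i,x)=f_i(x)$ and $\uparrow P_i\uparrow_{i\in I}=\{\uparrow f_i\uparrow_{i\in I}\mid f_i\in P_i\ \forall i\}$, which for relations is again (the problem of) a relation and is known to be the supremum in $(\mathbb{R}_0,\leq_0)$, a complete join-semilattice.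 A complete join-semilattice is distributive iff $x\leq\sup_i y_i$ implies the existence of $(x_i)_i$ with $x_i\leq y_i$ and $x=\sup_i x_i$. *)

(* Defs.v *)
From mathcomp Require Import all_boot all_classical.
From mathcomp Require Import topology.

Set Implicit Arguments.
Unset Strict Implicit.
Unset Printing Implicit Defensive.

Local Open Scope classical_set_scope.

(* A partial function from X to Y is a map f : X -> option Y, with None for
   "undefined"; composition of partial functions is ssrfun's [pcomp]. *)
Definition pdom (X Y : Type) (f : X -> option Y) : set X :=
  [set x | exists y, f x = Some y].

(* [pdom G], used as a type, carries the subspace topology of X. *)
Definition pcontinuous (X Y : topologicalType) (G : X -> option Y) : Prop :=
  exists2 g : pdom G -> Y,
    continuous g & forall x : pdom G, G (set_val x) = Some (g x).

Definition problem (X Z : topologicalType) : Type := set (X -> option Z).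

Definition problem_of_rel (X Z : topologicalType) (R : set (X * Z)) :
    problem X Z :=
  [set f | pdom f = [set x | exists z, R (x, z)]
           /\ forall x z, f x = Some z -> R (x, z)].

Definition le0 (X Y Z : topologicalType) (P : problem X Z) (Q : problem Y Z) :
    Prop :=
  exists2 G : X -> option Y, pcontinuous G & forall g, Q g -> P (pcomp g G).

Definition equiv0 (X Y Z : topologicalType) (P : problem X Z)
    (Q : problem Y Z) : Prop :=
  le0 P Q /\ le0 Q P.

Definition sup_fun (I Z : Type) (X : I -> Type)
    (f : forall i, X i -> option Z) : {i : I & X i} -> option Z :=
  fun u => f (projT1 u) (projT2 u).

(* The coproduct of the X i is {i : I & X i} with the library's sigT topology. *)
Definition sup_problem (Z : topologicalType) (I : choiceType)
    (X : I -> topologicalType) (P : forall i, problem (X i) Z) :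
    problem {i : I & X i} Z :=
  [set sup_fun f | f in [set f : forall i, X i -> option Z |
                           forall i, P i (f i)]].

(* Main.v *)
Require Import Defs.
From mathcomp Require Import all_boot all_classical.
From mathcomp Require Import topology.

(** Let [G] witness [R <=_0 sup_i S_i].  The sets [A_i] of the points that [G]
    maps into the [i]-th summand partition [dom G] into relatively open pieces.
    Take [R_i] to be the restriction of [R] to [A_i], still on the whole space
    [X].  The [i]-th component of [G] witnesses [R_i <=_0 S_i]; the maps
    [x |-> (i, x)], for [x] in [A_i], and [(i, x) |-> x] witness the equivalence
    of [R] with the supremum of the [R_i].  Since every relation has a choice
    function, [dom R] is contained in [dom G], so nothing is lost. *)

Local Open Scope classical_set_scope.

(** Relatively open preimages are represented by open sets of [X], which avoids the type [pdom G].
    Off the domain of [G] the set [V] is unconstrained. *)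
Lemma pcontinuousP (X Y : topologicalType) (G : X -> option Y) :
  pcontinuous G <->
  forall U, open U ->
    exists2 V, open V & forall x y, G x = Some y -> (V x <-> U y).
Proof.
split=> [[g /continuousP gc gE] U /gc [V oV VE]|Gc].
  exists V => // x y Gxy.
  have xG : x \in pdom G by apply/mem_set; exists y.
  pose a : pdom G := exist _ x xG.
  have <- : g a = y by have := gE a; rewrite {1}/set_val/= Gxy => -[].
  have -> : U (g a) = (g @^-1` U) a by [].
  by rewrite -VE.
pose g (a : pdom G) : Y := sval (cid (set_mem (valP a))).
have gE a : G (set_val a) = Some (g a) by rewrite /g; case: cid.
exists g => //; apply/continuousP => U /Gc[V oV VE].
by exists V => //; apply/seteqP; split=> a /= /(VE _ _ (gE a)).
Qed.

Lemma problem_of_relP {X Z : topologicalType} {R : set (X * Z)}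
    {f : X -> option Z} :
  problem_of_rel R f <->
  (forall x z, f x = Some z -> R (x, z)) /\
  (forall x z, R (x, z) -> pdom f x).
Proof.
split=> [[fE fR]|[fR Rf]]; split=> //.
  by move=> x z Rxz; rewrite fE; exists z.
apply/seteqP; split=> x [z]; last exact: Rf.
by move=> /fR; exists z.
Qed.

Lemma problem_of_rel_nonempty (X Z : topologicalType) (R : set (X * Z)) :
  exists f, problem_of_rel R f.
Proof.
have /choice[f fP] x : exists o, (forall z, o = Some z -> R (x, z)) /\
    ((exists z, R (x, z)) -> exists z, o = Some z).
  have [[z Rxz]|nR] := pselect (exists z, R (x, z)).
    by exists (Some z); split=> [_ [<-]//|_]; exists z.
  by exists None.
exists f; apply/problem_of_relP; split=> x z; first exact: (fP x).1.
by move=> Rxz; apply: (fP x).2; exists z.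
Qed.

Section component.
Context {I : choiceType} {Y : I -> topologicalType}.

(** Partial inverse of the injection [existT Y i]; the test also yields the equality needed to
    transport [projT2 u] to [Y i]. *)
Definition component (i : I) (u : {i & Y i}) : option (Y i) :=
  if projT1 u =P i is ReflectT e then Some (eq_rect _ Y (projT2 u) i e)
  else None.

Lemma componentP (i : I) (u : {i & Y i}) (y : Y i) :
  component i u = Some y <-> u = existT Y i y.
Proof.
rewrite /component; case: u => j y' /=; case: eqP => [e|ne]; split=> //.
- by case: i / e y => y [->].
- by case: i / e y => y e; congr Some; exact: existT_inj2 e.
- by move=> e; case: ne; exact: existT_inj1 e.
Qed.

Lemma pcomp_componentP {X : Type} {G : X -> option {i & Y i}} {i x y} :
  pcomp (component i) G x = Some y <-> G x = Some (existT Y i y).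
Proof.
rewrite /pcomp; case: (G x) => //= u.
by split=> [/componentP ->//|[/componentP]].
Qed.

(** The injection [existT Y i] is an open map, so the preimage of [U] is the preimage under [G] of
    the open image of [U]. *)
Lemma pcontinuous_component (X : topologicalType) (G : X -> option {i & Y i})
    (i : I) : pcontinuous G -> pcontinuous (pcomp (component i) G).
Proof.
move=> /pcontinuousP Gc; apply/pcontinuousP => U /(existT_open_map i).
move=> /Gc[V oV VE]; exists V => // x y /pcomp_componentP /VE VxE.
apply: (iff_trans VxE); split=> [[y' Uy' e]|Uy]; last by exists y.
by rewrite -(existT_inj2 e).
Qed.

End component.

Theorem theorem4p24 (Z : topologicalType) (X : topologicalType)
    (R : set (X * Z)) (I : choiceType) (Y : I -> topologicalType)
    (S : forall i : I, set (Y i * Z)) :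
  le0 (problem_of_rel R) (sup_problem (fun i => problem_of_rel (S i))) ->
  exists (X' : I -> topologicalType) (R' : forall i : I, set (X' i * Z)),
    (forall i : I, le0 (problem_of_rel (R' i)) (problem_of_rel (S i))) /\
    equiv0 (problem_of_rel R) (sup_problem (fun i => problem_of_rel (R' i))).
Proof.
move=> [G Gc GR].
(* The hypothesis on [G] applies only to full families of choice functions; [g0] supplies the other
   members when a single one is given. *)
have [g0 g0S] : exists g : forall i, Y i -> option Z,
    forall i, problem_of_rel (S i) (g i).
  by exists (fun i => sval (cid (problem_of_rel_nonempty _ _ (S i)))) => i;
     case: cid.
have GRf g : (forall i, problem_of_rel (S i) (g i)) ->
    problem_of_rel R (pcomp (sup_fun g) G) by move=> gS; apply: GR; exists g.
have RG x z : R (x, z) -> exists i y, G x = Some (existT Y i y).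
  have /problem_of_relP[_ /[apply]] := GRf _ g0S.
  by rewrite /pdom /pcomp/=; case: (G x) => [[i y] _|[]//]; exists i, y.
pose A i x := exists y, G x = Some (existT Y i y).
exists (fun=> X), (fun i => [set p | R p /\ A i p.1]); split=> [i|].
  exists (pcomp (component i) G); first exact: pcontinuous_component.
  (* [h] is [g0] with its [i]-th member replaced by [g]. On [A i] only this member is evaluated. *)
  move=> g gS; pose h := dfwith g0 i g.
  have hi : h i = g by rewrite /h dfwithin.
  have /GRf/problem_of_relP[hR Rh] : forall j, problem_of_rel (S j) (h j).
    move=> j; have [e|ne] := eqVneq i j; last by rewrite /h dfwithout.
    by case: j / e; rewrite hi.
  have GhE x y : G x = Some (existT Y i y) ->
      pcomp g (pcomp (component i) G) x = pcomp (sup_fun h) G x.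
    move=> Gx; rewrite {1}/pcomp (pcomp_componentP.2 Gx) /pcomp Gx /=.
    by rewrite /sup_fun/= hi.
  apply/problem_of_relP; split=> x z /=.
    move=> gx; have [y /pcomp_componentP Gx] :
        exists y, pcomp (component i) G x = Some y.
      by move: gx; rewrite {1}/pcomp; case: (pcomp _ _ x) => // y; exists y.
    by split; [apply: hR; rewrite -(GhE _ _ Gx)|exists y].
  by move=> [Rxz [y Gx]]; rewrite /pdom/= (GhE _ _ Gx); exact: Rh Rxz.
split.
- exists (fun x => omap (fun u => existT (fun=> X) (projT1 u) x) (G x)).
    move/pcontinuousP: Gc => Gc; apply/pcontinuousP => U /sigT_openP oU.
    (* [W i] is an open set that agrees with [A i] on the domain of [G], so there only the index of
       [G x] contributes to the union below. *)
    have /choice[W WP] i : exists W, open W /\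
        forall x u, G x = Some u -> (W x <-> projT1 u = i).
      have [W oW WE] := Gc _ (existT_open_map i setT openT).
      exists W; split=> // x [j y] /WE WxE.
      apply: (iff_trans WxE).
      split=> [[y' _ e]|e]; first by rewrite (existT_inj1 e).
      by rewrite /= in e; case: i / e {oW WE WxE}; exists y.
    exists (\bigcup_i (W i `&` existT (fun=> X) i @^-1` U)).
      by apply: bigcup_open => i _; apply: openI => //; exact: (WP i).1.
    move=> x v; case Gx: (G x) => [u|]//= [<-]; split.
      by move=> [i _ [/((WP i).2 _ _ Gx) <-]].
    by exists (projT1 u) => //; split=> //; exact/((WP _).2 _ _ Gx).
  move=> _ [f fR' <-]; apply/problem_of_relP; split=> x z.
    rewrite /pcomp; case: (G x) => //= u; rewrite /sup_fun/= => fx.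
    by have /problem_of_relP[/(_ _ _ fx) []] := fR' (projT1 u).
  move=> Rxz; have [i [y Gx]] := RG _ _ Rxz.
  rewrite /pdom/= /pcomp Gx /= /sup_fun/=.
  have /problem_of_relP[_ fd] := fR' i.
  by apply: (fd x z); split=> //; exists y.
(* [K] is undefined at [(i, x)] when [x] is outside [A i], since a choice function of the [i]-th
   restriction must be undefined there. *)
- pose K (u : {i : I & X}) : option X :=
    if pselect (A (projT1 u) (projT2 u)) then Some (projT2 u) else None.
  exists K.
    apply/pcontinuousP => U oU; exists (@projT2 I (fun=> X) @^-1` U).
      exact/sigT_openP.
    by move=> u x; rewrite /K; case: pselect => // _ [<-].
  move=> f /problem_of_relP[fR Rf].
  exists (fun i x => pcomp f K (existT (fun=> X) i x)); last first.
    by apply/funext => -[i x].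
  move=> i; apply/problem_of_relP; split=> x z; rewrite /pdom /pcomp /K/=.
    by case: pselect => //= Ax /fR.
  by move=> [Rxz Ax]; case: pselect => //= _; exact: Rf Rxz.
Qed.
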